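(* Let $d,n\ge1$, let $A_0,A_1,\dots,A_n\in\mathbb{C}^{d\times d}_{\mathrm{herm}}$, and put $\Phi(S)=\sum_{i=1}^nA_iSA_i$. Let $c\in\mathbb{R}$ and $Z\in\mathbb{C}^{d\times d}_{\mathrm{herm}}$ satisfy $$\begin{bmatrix} cI_d-A_0-\Phi(Z) & I_d\\ I_d & Z\end{bmatrix}\succeq0$$ (which implies $Z\succ0$). Define $\Psi_Z(S)=Z\,\Phi(S)\,Z$ for $S\in\mathbb{C}^{d\times d}_{\mathrm{herm}}$. Suppose that $S\in\mathbb{C}^{d\times d}_{\mathrm{herm}}$ satisfies $S\succeq0$, $\mathrm{Tr}(S)=1$, and $$\Psi_Z(S)=Z\,\Phi(S)\,Z=\rho S$$ for some $\rho>0$. Then $$c-\langle cI_d-A_0-\Phi(Z)-Z^{-1},S\rangle-(\sqrt\rho-1)^2\langle Z^{-1},S\rangle\le\Lambda_{\mathrm{sc}}(A_0,A_1,\dots,A_n)\le c.$$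
   Context: $\mathbb{C}^{d\times d}_{\mathrm{herm}}$ is the set of $d\times d$ complex Hermitian matrices; $\succeq$, $\succ$ denote the Loewner order; $\langle X,Y\rangle=\mathrm{Tr}(X^*Y)$. For a bounded self-adjoint operator, $\lambda_{\max}$ is the maximum of its spectrum. A free semicircular family $(s_i)_{i=1}^n$ consists of freely independent self-adjoint operators each with the standard semicircle law on $[-2,2]$; concretely $s_i=l_i+l_i^*$ with $l_i$ the creation operators on the full Fock space over $\mathbb{C}^n$ associated to the standard basis vectors. Define $\Lambda_{\mathrm{sc}}(A_0,\dots,A_n)=\lambda_{\max}\big(A_0\otimes 1+\sum_{i=1}^n A_i\otimes s_i\big)$. Known theorem of Lehner (1999), which may be taken as an equivalent definition: $\Lambda_{\mathrm{sc}}(A_0,\dots,A_n)=\inf_{Z\in\mathbb{C}^{d\times d}_{\mathrm{herm}},Z\succ 0}\lambda_{\max}\big(Z+A_0+\sum_{i=1}^n A_iZ^{-1}A_i\big)$. *)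

(* Defs.v *)
(* MathComp / MathComp-Analysis; complex scalars are [R[i]] for [R : realType]. *)
From mathcomp Require Import all_boot all_order all_algebra.
From mathcomp Require Import all_classical all_reals esum.
From mathcomp Require Export complex.

Set Implicit Arguments.
Unset Strict Implicit.
Unset Printing Implicit Defensive.

Import Order.TTheory GRing.Theory Num.Theory.
Local Open Scope ring_scope.
Local Open Scope classical_set_scope.
Local Open Scope sesquilinear_scope.
Local Open Scope complex_scope.

Section Matrices.
Variables (R : realType).
Local Notation C := R[i].

(* On [R[i]], [0 <= z] means that [z] is real and nonnegative. *)
Definition psdmx d (M : 'M[C]_d) : Prop :=
  M \is hermsymmx /\ forall v : 'cV[C]_d, 0 <= (v ^t* *m M *m v) 0 0.

Definition mxinner d (X Y : 'M[C]_d) : C := \tr (X ^t* *m Y).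

Definition Phi d n (A : 'I_n -> 'M[C]_d) (S : 'M[C]_d) : 'M[C]_d :=
  \sum_(i < n) A i *m S *m A i.

Definition Psi d n (A : 'I_n -> 'M[C]_d) (Z S : 'M[C]_d) : 'M[C]_d :=
  Z *m Phi A S *m Z.

End Matrices.

(* The Hilbert space l^2(I) is the set of square-summable families
   [x : I -> R[i]].  Operators are represented by maps on all families, and only
   their action on l^2(I) is relevant. *)
Section SquareSummable.
Variables (R : realType) (I : choiceType).
Local Notation C := R[i].

Definition l2normsq (x : I -> C) : \bar R :=
  (\esum_(i in [set: I]) ((ComplexField.Normc.normc (x i)) ^+ 2)%:E)%E.

Definition l2 (x : I -> C) : Prop := (l2normsq x < +oo)%E.

Definition bounded_op (T : (I -> C) -> (I -> C)) : Prop :=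
  exists K : R, forall x, l2 x -> (l2normsq (T x) <= K%:E * l2normsq x)%E.

(* [z] is in the resolvent set when [T - z] has a bounded two-sided inverse on
   l^2(I); such an inverse is linear as soon as [T] is. *)
Definition spectrum (T : (I -> C) -> (I -> C)) : set C :=
  [set z | ~ exists U : (I -> C) -> (I -> C),
    [/\ bounded_op U,
        forall x, l2 x -> U (fun i => T x i - z * x i) = x &
        forall x, l2 x -> (fun i => T (U x) i - z * U x i) = x]].

(* For [T] bounded and self-adjoint the spectrum is real, nonempty and compact,
   so that this supremum is its maximum. *)
Definition lambda_max (T : (I -> C) -> (I -> C)) : R :=
  sup [set t : R | spectrum T t%:C].

End SquareSummable.

(* The full Fock space over C^n is l^2 of the words in n letters: the basis
   vector of the word [:: i1; ...; ik] is e_i1 (x) ... (x) e_ik, and the empty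
   word is the vacuum. *)
Section Fock.
Variables (R : realType) (n : nat).
Local Notation C := R[i].
Local Notation word := (seq 'I_n).

(* Left creation: the basis vector of [w] is sent to that of [i :: w]. *)
Definition creation (i : 'I_n) (x : word -> C) : word -> C :=
  fun w => if w is j :: v then (if j == i then x v else 0) else 0.

(* The adjoint of [creation i]. *)
Definition annihilation (i : 'I_n) (x : word -> C) : word -> C :=
  fun w => x (i :: w).

Definition semicircular (i : 'I_n) (x : word -> C) : word -> C :=
  fun w => creation i x w + annihilation i x w.

(* [A (x) s] on C^d (x) l^2(words) = l^2('I_d * words). *)
Definition tensop d (A : 'M[C]_d) (s : (word -> C) -> (word -> C))
    (x : 'I_d * word -> C) : 'I_d * word -> C :=
  fun p => \sum_(b < d) A p.1 b * s (fun w => x (b, w)) p.2.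

Definition Xsc d (A0 : 'M[C]_d) (A : 'I_n -> 'M[C]_d)
    (x : 'I_d * word -> C) : 'I_d * word -> C :=
  fun p => tensop A0 id x p + \sum_(i < n) tensop (A i) (semicircular i) x p.

Definition Lambda_sc d (A0 : 'M[C]_d) (A : 'I_n -> 'M[C]_d) : R :=
  lambda_max (Xsc A0 A).

End Fock.

(* Main.v *)
Require Import Defs.
From mathcomp Require Import all_boot all_order all_algebra.
From mathcomp Require Import all_classical all_reals esum.
From mathcomp Require Import ereal topology normedtype sequences.
From mathcomp Require Import ring lra.

Set Implicit Arguments.
Unset Strict Implicit.
Unset Printing Implicit Defensive.

Import Order.TTheory GRing.Theory Num.Theory numFieldNormedType.Exports.
Local Open Scope ring_scope.
Local Open Scope complex_scope.

Local Notation Re := complex.Re.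
Local Notation Im := complex.Im.

(** The spectral bound is a statement about a quadratic form.  The operator
    [Xsc A0 A] is local: a component along a word only depends on the components
    along words one letter shorter, equal or one letter longer.  So it maps
    finitely supported vectors to finitely supported vectors, and its form on
    these is a finite sum.  For a symmetric local operator [T] whose form lies
    between two constants, [lambda_max T] is the least constant [m] with
    [<x, T x> <= m <x, x>] for all finitely supported [x] ([lambda_max_form]).
    Both halves rest on one inequality ([sqnorm_le_form]): a form between [0]
    and [K] satisfies [|T x|^2 <= K <x, T x>].
    - Above [m] it makes [G = 1 - (t - T) / K] a strict contraction, so
      that [t - T] is inverted by a Neumann series.  Locality lets [T] pass
      to coordinatewise limits, so the series only has to converge coordinate
      by coordinate.
    - At [m] a bounded inverse of [T - m] would give
      [|x|^2 <= k |(T - m) x|^2 <= k K <x, (m - T) x>], and [m] could be lowered.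

    Upper bound.  The matrix inequality says that [Z] is invertible and, with
    [W = Z^-1], that [A0 + Phi Z + W <= c] (Schur complement).  Split the form of
    [Xsc A0 A] along words.  The interaction terms are [2 Re <x_(iw), A_i x_w>],
    and each is at most [<x_(iw), W x_(iw)> + <A_i x_w, Z A_i x_w>].  Every nonempty
    word is [iw] in exactly one way, so the sum is at most the form of
    [W + Phi Z] ([Xsc_form_le]).

    Lower bound.  Since [Z Phi(S) Z = rho S], the trace of [Phi(Z) S] equals that
    of [rho W S], and the left-hand side of the claim simplifies to
    [tr (A0 S) + 2 sqrt rho tr (W S)].  This is the limiting energy of explicit
    trial vectors: factor [S = V V^*] and put [Y_[] = V],
    [Y_(iw) = rho^(-1/2) Z A_i Y_w].  The eigenvalue equation says that the
    matrices [Y_w Y_w^*] over the words of any fixed length sum to [S]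
    ([trial_moment]).  The columns of [Y], cut off at length [N], therefore have total
    squared norm [N + 1] and total energy
    [(N + 1) tr (A0 S) + 2 N sqrt rho tr (W S)] ([trial_bound]); divide by [N + 1]
    and let [N] grow. *)

(** * Real and imaginary parts *)

Section ComplexParts.
Variable R : realType.
Implicit Types (x y : R[i]) (a : R).
Local Notation normc := ComplexField.Normc.normc.

Lemma cReD x y : Re (x + y) = Re x + Re y.
Proof. by case: x y => [? ?] [? ?]. Qed.

Lemma cImD x y : Im (x + y) = Im x + Im y.
Proof. by case: x y => [? ?] [? ?]. Qed.

Lemma cReZ a x : Re (a%:C * x) = a * Re x.
Proof. by case: x => [? ?] /=; rewrite mul0r subr0. Qed.

Lemma cImZ a x : Im (a%:C * x) = a * Im x.
Proof. by case: x => [? ?] /=; rewrite mul0r addr0. Qed.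

Lemma cReN x : Re (- x) = - Re x.
Proof. by case: x. Qed.

Lemma cImN x : Im (- x) = - Im x.
Proof. by case: x. Qed.

Lemma Re_sum (J : Type) (s : seq J) (f : J -> R[i]) :
  Re (\sum_(j <- s) f j) = \sum_(j <- s) Re (f j).
Proof. by elim/big_ind2: _ => // ? ? ? ? <- <-; rewrite cReD. Qed.

Lemma conj_conjc x : (x^*)%R = x^*%C.
Proof.
by [].
Qed.

Lemma cRe_conj x : Re (x^*)%R = Re x.
Proof. by rewrite conj_conjc; case: x. Qed.

Lemma normc_sqr x : normc x ^+ 2 = Re x ^+ 2 + Im x ^+ 2.
Proof. by case: x => a b; rewrite sqr_sqrtr // addr_ge0 // sqr_ge0. Qed.

Lemma normc_sqrE x : (normc x ^+ 2)%:C = ((x^*)%R * x).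
Proof.
rewrite normc_sqr conj_conjc; case: x => a b /=.
by apply/eqP; rewrite eq_complex /=; apply/andP; split; apply/eqP; ring.
Qed.

Lemma normc_sqrB x y :
  normc (x - y) ^+ 2 = (Re x - Re y) ^+ 2 + (Im x - Im y) ^+ 2.
Proof. by rewrite normc_sqr cReD cReN cImD cImN. Qed.

Lemma norm_le_sqr (a b : R) : 0 <= b -> (`|a| <= b) = (a ^+ 2 <= b ^+ 2).
Proof.
by move=> b0; rewrite -[RHS]ler_sqrt ?sqr_ge0 // !sqrtr_sqr (ger0_norm b0).
Qed.

End ComplexParts.

(** * Symmetric local operators on families over a filtered index set *)

(** The finite sets [F N] exhaust the index set.  All sums below run over one
    [F N], so that no infinite inner product has to be defined. *)
Section LocalOperators.
Variables (R : realType) (I : choiceType) (F : nat -> seq I).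
Hypothesis F_uniq : forall N, uniq (F N).
Hypothesis F_sub : forall N, {subset F N <= F N.+1}.
Hypothesis F_cover : forall i, exists N, i \in F N.
Local Notation C := R[i].
Local Notation normc := ComplexField.Normc.normc.
Implicit Types (x y : I -> C) (T : (I -> C) -> (I -> C)).

Definition ip N x y : C := \sum_(i <- F N) (x i)^*%R * y i.

Definition sqnorm N x : R := \sum_(i <- F N) normc (x i) ^+ 2.

Definition supported N x := forall i, i \notin F N -> x i = 0.

(** The algebraic content of self-adjointness, for an operator whose matrix has
    band width one for the filtration.  [ls_local] lets the operator act on
    arbitrary families, [ls_supp] keeps its form finite. *)
Record local_sym T : Prop := LocalSym {
  ls_linear : forall (a : C) x y i,
    T (fun j => x j + a * y j) i = T x i + a * T y i;
  ls_local : forall N x y, {in F N.+1, x =1 y} -> {in F N, T x =1 T y};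
  ls_supp : forall N x, supported N x -> supported N.+1 (T x);
  ls_sym : forall N x y, supported N x -> supported N y -> ip N x (T y) = ip N (T x) y }.

Definition form_le T c :=
  forall N x, supported N x -> Re (ip N x (T x)) <= c * sqnorm N x.

Definition form_ge T c :=
  forall N x, supported N x -> c * sqnorm N x <= Re (ip N x (T x)).

Lemma F_mono N M : (N <= M)%N -> {subset F N <= F M}.
Proof.
move=> /subnK <-; elim: (M - N)%N => [|k IH] // i /IH; exact: F_sub.
Qed.

Lemma supp_mono N M x : (N <= M)%N -> supported N x -> supported M x.
Proof. by move=> leNM sx i iM; apply: sx; apply: contra iM; apply: F_mono. Qed.

Lemma big_F_mono (V : nmodType) N M (f : I -> V) : (N <= M)%N ->
  (forall i, i \notin F N -> f i = 0) ->
  \sum_(i <- F M) f i = \sum_(i <- F N) f i.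
Proof.
move=> leNM f0; rewrite (bigID (mem (F N))) /= [X in _ + X]big1 ?addr0; last first.
  by move=> i; exact: f0.
rewrite -big_filter; apply: perm_big; apply: uniq_perm => //.
  exact: filter_uniq.
move=> i; rewrite mem_filter /=; case: (boolP (i \in F N)) => //= iN.
exact: F_mono iN.
Qed.

Lemma ip_monol N M x y : (N <= M)%N -> supported N x -> ip M x y = ip N x y.
Proof.
by move=> leNM sx; apply: big_F_mono => // i /sx ->; rewrite conjC0 mul0r.
Qed.

Lemma sqnorm_mono N M x : (N <= M)%N -> supported N x -> sqnorm M x = sqnorm N x.
Proof.
move=> leNM sx; apply: big_F_mono => // i /sx ->.
by rewrite ComplexField.Normc.normc0 expr0n.
Qed.

Lemma sqnormE N x : (sqnorm N x)%:C = ip N x x.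
Proof.
rewrite /sqnorm rmorph_sum /=; apply: eq_bigr => i _; exact: normc_sqrE.
Qed.

Lemma Re_ip N x : Re (ip N x x) = sqnorm N x.
Proof. by rewrite -sqnormE. Qed.

Lemma sqnorm_ge0 N x : 0 <= sqnorm N x.
Proof. by apply: sumr_ge0 => i _; apply: sqr_ge0. Qed.

Lemma sum_le_sqnorm s N x : uniq s -> {subset s <= F N} ->
  \sum_(i <- s) normc (x i) ^+ 2 <= sqnorm N x.
Proof.
move=> us sN; rewrite /sqnorm [leRHS](bigID (mem s)) /=.
rewrite -[X in _ <= X + _]big_filter.
rewrite (perm_big s (r1 := [seq i <- F N | i \in s])) /=; last first.
  apply: uniq_perm => //; first exact: filter_uniq.
  move=> i; rewrite mem_filter /=; case: (boolP (i \in s)) => //= iN.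
  exact: sN iN.
by rewrite lerDl sumr_ge0 // => i _; apply: sqr_ge0.
Qed.

Lemma le_sqnorm N M x : (N <= M)%N -> sqnorm N x <= sqnorm M x.
Proof. by move=> leNM; apply: sum_le_sqnorm => // i; apply: F_mono. Qed.

Lemma sqnorm_ge_term N x i : i \in F N -> normc (x i) ^+ 2 <= sqnorm N x.
Proof.
move=> iN; rewrite /sqnorm (bigD1_seq i) //= lerDl sumr_ge0 // => j _.
exact: sqr_ge0.
Qed.

(** The free weight [s] is what later allows a contraction factor [q < 1] to be
    preserved by an affine iteration. *)
Lemma sqnormD N x y (s : R) : 0 < s ->
  sqnorm N (fun i => x i + y i) <= (1 + s) * sqnorm N x + (1 + s^-1) * sqnorm N y.
Proof.
move=> s0; rewrite /sqnorm !mulr_sumr -big_split /=; apply: ler_sum => i _.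
have h (a b : R) : (a + b) ^+ 2 <= (1 + s) * a ^+ 2 + (1 + s^-1) * b ^+ 2.
  have -> : (1 + s) * a ^+ 2 + (1 + s^-1) * b ^+ 2
      = (a + b) ^+ 2 + s^-1 * (s * a - b) ^+ 2 by field; rewrite gt_eqF.
  by rewrite lerDl mulr_ge0 ?sqr_ge0 // invr_ge0 ltW.
rewrite !normc_sqr cReD cImD; have := h (Re (x i)) (Re (y i)).
by have := h (Im (x i)) (Im (y i)); lra.
Qed.

Lemma sqnormN N x : sqnorm N (fun i => - x i) = sqnorm N x.
Proof.
by apply: eq_bigr => i _; rewrite !normc_sqr cReN cImN !sqrrN.
Qed.

Lemma sqnormZ N (a : R) x : sqnorm N (fun i => a%:C * x i) = a ^+ 2 * sqnorm N x.
Proof.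
rewrite /sqnorm mulr_sumr; apply: eq_bigr => i _.
by rewrite !normc_sqr cReZ cImZ; ring.
Qed.

Lemma eq_sqnorm N x y : {in F N, x =1 y} -> sqnorm N x = sqnorm N y.
Proof. by move=> e; apply: eq_big_seq => i /e ->. Qed.

Lemma ipDr N x y z a :
  ip N x (fun i => y i + a * z i) = ip N x y + a * ip N x z.
Proof.
rewrite /ip mulr_sumr -big_split /=; apply: eq_bigr => i _.
by rewrite mulrDr mulrCA.
Qed.

Lemma ip_conj N x y : (ip N x y)^*%R = ip N y x.
Proof.
rewrite /ip rmorph_sum /=; apply: eq_bigr => i _.
by rewrite rmorphM /= conjCK mulrC.
Qed.

Lemma ipDl N x y z (a : R) :
  ip N (fun i => x i + a%:C * y i) z = ip N x z + a%:C * ip N y z.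
Proof.
rewrite -ip_conj ipDr rmorphD rmorphM /= !ip_conj.
by rewrite (conj_conjc a%:C) conjc_real.
Qed.

Definition affine (a b : R) T : (I -> C) -> (I -> C) :=
  fun x i => a%:C * x i + b%:C * T x i.

Lemma affine_sym a b T : local_sym T -> local_sym (affine a b T).
Proof.
case=> lin loc spr sym; split.
- move=> k x y i; rewrite /affine lin; ring.
- move=> N x y e i iN; rewrite /affine (loc N x y) // e //; exact: F_sub.
- move=> N x sx i iN; rewrite /affine (spr N x) // (supp_mono (leqnSn N) sx) //.
  by rewrite !mulr0 addr0.
- move=> N x y sx sy.
  have -> : affine a b T x = fun i => (fun j => a%:C * x j) i + b%:C * T x i by [].
  rewrite ipDl -sym //.
  have -> : affine a b T y = fun i => (fun j => a%:C * y j) i + b%:C * T y i by [].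
  rewrite ipDr; congr (_ + _); rewrite /ip; apply: eq_bigr => i _.
  by rewrite rmorphM /= (conj_conjc a%:C) conjc_real mulrCA mulrA.
Qed.

Lemma Re_ip_affine a b T N x :
  Re (ip N x (affine a b T x)) = a * sqnorm N x + b * Re (ip N x (T x)).
Proof.
have -> : affine a b T x = fun i => (fun j => a%:C * x j) i + b%:C * T x i by [].
rewrite ipDr cReD cReZ; congr (_ + _); rewrite -Re_ip -cReZ; congr Re.
by rewrite /ip mulr_sumr; apply: eq_bigr => i _; rewrite mulrCA.
Qed.

(** Expand [0 <= <z, T z>] at [z = x - T x / K]: the cross terms are
    [- 2 |T x|^2 / K] by symmetry, and [<T x, T (T x)> <= K |T x|^2]. *)
Lemma sqnorm_le_form T K : local_sym T -> 0 < K -> form_ge T 0 -> form_le T K ->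
  forall N x, supported N x -> sqnorm N.+1 (T x) <= K * Re (ip N x (T x)).
Proof.
move=> LT K0 T0 TK N x sx; have [lin loc spr sym] := LT.
have sTx := spr _ _ sx; have sTTx := spr _ _ sTx.
pose z := fun i => x i + (- K^-1)%:C * T x i.
have sx1 := supp_mono (leqnSn N) sx.
have sz : supported N.+1 z.
  by move=> i iN; rewrite /z sx1 // sTx // mulr0 addr0.
have Tz : T z = fun i => T x i + (- K^-1)%:C * T (T x) i.
  by apply: funext => i; rewrite /z lin.
have := T0 _ _ sz; rewrite mul0r Tz ipDr {1 2}/z !ipDl.
rewrite (sym N.+1 x (T x)) // !cReD !cReZ !cReD !cReZ.
rewrite (ip_monol _ (leqnSn N) sx) Re_ip.
have := TK _ _ sTx; set a := Re (ip N.+1 _ _); set b := sqnorm _ _.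
set e := Re (ip N x _) => h1 h2.
rewrite -(ler_pM2l (_ : 0 < K^-1)) ?invr_gt0 // mulKf ?gt_eqF //.
have h3 : K^-1 * (K^-1 * a) <= K^-1 * b.
  by rewrite ler_pM2l ?invr_gt0 // ler_pdivrMl.
lra.
Qed.

(** A contraction estimate on finitely supported vectors passes to all vectors,
    because [T x] on [F N] only sees [x] on [F N.+1]. *)
Lemma sqnorm_contract T q : local_sym T -> 0 < q -> form_ge T 0 -> form_le T q ->
  forall N x, sqnorm N (T x) <= q ^+ 2 * sqnorm N.+1 x.
Proof.
move=> LT q0 T0 Tq N x; have [lin loc spr sym] := LT.
pose x' i := if i \in F N.+1 then x i else 0.
have sx' : supported N.+1 x' by move=> i iN; rewrite /x' (negbTE iN).
have ex : {in F N.+1, x =1 x'} by move=> i iN; rewrite /x' iN.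
rewrite (eq_sqnorm (loc _ _ _ ex)) (eq_sqnorm ex).
apply: le_trans (_ : sqnorm N.+2 (T x') <= _); first exact/le_sqnorm/leqW/leqnSn.
apply: le_trans (sqnorm_le_form LT q0 T0 Tq sx') _.
by rewrite expr2 -mulrA ler_pM2l // Tq.
Qed.

(** * Square-summable families and the Neumann series *)

Definition bounded_by x L := forall N, sqnorm N x <= L.

Lemma F_cover_seq (s : seq I) : exists N, {subset s <= F N}.
Proof.
elim: s => [|i s [N sN]]; first by exists 0%N.
have [M iM] := F_cover i; exists (maxn N M) => j; rewrite inE => /predU1P[->|/sN].
  exact: F_mono (leq_maxr _ _) _ iM.
exact/F_mono/leq_maxl.
Qed.

Lemma l2normsq_le x L : (l2normsq x <= L%:E)%E <-> bounded_by x L.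
Proof.
split=> [h N|h].
  rewrite -lee_fin; apply: le_trans h; apply: esum_ge.
  exists [set` F N]%classic; first by split.
  by rewrite -fsbig_seq //= sumEFin.
rewrite /l2normsq /esum; apply: ge_ereal_sup => _ [A [finA _]] <-.
rewrite fsbig_finite //= sumEFin lee_fin.
have [N sN] := F_cover_seq (finmap.enum_fset (fset_set A)).
by apply: le_trans (h N); apply: sum_le_sqnorm.
Qed.

Lemma l2normsq_fin x : l2 x -> exists2 l, l2normsq x = l%:E & 0 <= l.
Proof.
have x0 : (0 <= l2normsq x)%E.
  by apply: esum_ge0 => i _; rewrite lee_fin sqr_ge0.
rewrite /l2; case: (l2normsq x) x0 => // l; rewrite lee_fin => l0 _; by exists l.
Qed.

Lemma l2P x : l2 x <-> exists L, bounded_by x L.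
Proof.
split=> [/l2normsq_fin [l e _]|[L h]].
  by exists l; apply/l2normsq_le; rewrite e.
rewrite /l2; apply: le_lt_trans (ltry L); exact/l2normsq_le.
Qed.

(** Boundedness in terms of finite sums only, which frees the construction of
    resolvents from extended reals. *)
Lemma bounded_opP U :
  bounded_op U <-> exists K, forall x L, bounded_by x L -> bounded_by (U x) (K * L).
Proof.
split=> [[K h]|[K h]].
  exists (Num.max K 0) => x L xL.
  have x2 : l2 x by apply/l2P; exists L.
  have [l e l0] := l2normsq_fin x2.
  have lL : l <= L by rewrite -lee_fin -e; apply/l2normsq_le.
  have := h _ x2; rewrite e -EFinM => /l2normsq_le h' N.
  apply: le_trans (h' N) _; apply: le_trans (_ : Num.max K 0 * l <= _).
    by rewrite ler_wpM2r // le_max lexx.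
  by rewrite ler_wpM2l // le_max lexx orbT.
exists K => x x2; have [l e l0] := l2normsq_fin x2.
rewrite e -EFinM; apply/l2normsq_le; apply: h; apply/l2normsq_le; by rewrite e.
Qed.

(** The sequences [u m - E q^m] and [u m + E q^m], with [E = D / (1 - q)], are
    monotone and enclose the limit. *)
Lemma geometric_limit (u : nat -> R) (D q : R) : 0 < q < 1 -> 0 <= D ->
  (forall m, `|u m.+1 - u m| <= D * q ^+ m) ->
  exists l, forall m, `|l - u m| <= D / (1 - q) * q ^+ m.
Proof.
move=> /andP[q0 q1] D0 h; pose E := D / (1 - q).
have E0 : 0 <= E by rewrite divr_ge0 // subr_ge0 ltW.
have DE : D = E * (1 - q) by rewrite divfK // subr_eq0 gt_eqF.
have qm m : 0 <= E * q ^+ m by rewrite mulr_ge0 // exprn_ge0 // ltW.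
pose w m := u m - E * q ^+ m; pose v m := u m + E * q ^+ m.
have wS m : w m <= w m.+1.
  have := h m; rewrite ler_norml DE /w exprS => /andP[]; lra.
have vS m : v m.+1 <= v m.
  have := h m; rewrite ler_norml DE /v exprS => /andP[]; lra.
have wD m k : w m <= w (m + k)%N.
  by elim: k => [|k IH]; rewrite ?addn0 // addnS (le_trans IH).
have vD m k : v (m + k)%N <= v m.
  by elim: k => [|k IH]; rewrite ?addn0 // addnS (le_trans _ IH).
have wv m k : w m <= v k.
  apply: le_trans (wD m k) _; rewrite addnC.
  apply: le_trans (vD k m); rewrite /w /v; have := qm (k + m)%N; lra.
have hs : has_sup (range w)%classic.
  split; first by exists (w 0%N); exists 0%N.
  by exists (v 0%N) => _ [m _ <-].
exists (sup (range w)%classic) => m.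
have h1 : w m <= sup (range w)%classic by apply: ub_le_sup; [case: hs|exists m].
have h2 : sup (range w)%classic <= v m.
  by apply: ge_sup; [case: hs|move=> _ [k _ <-]].
by rewrite ler_norml; apply/andP; move: h1 h2; rewrite /w /v /E; split; lra.
Qed.

Lemma geometric_small (D q e : R) : 0 < q < 1 -> 0 < e ->
  exists m0, forall m, (m0 <= m)%N -> D * q ^+ m <= e.
Proof.
move=> /andP[q0 q1] e0.
have nq : `|q| < 1 by rewrite gtr0_norm.
move: (cvg_geometric D nq) => /cvgrPdist_le /(_ e e0) [m0 _ h]; exists m0 => m /h.
by rewrite sub0r normrN /= => /(le_trans (ler_norm _)).
Qed.

Section Neumann.
Variables (G : (I -> C) -> (I -> C)) (q : R).
Hypotheses (LG : local_sym G) (q01 : 0 < q < 1).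
Hypotheses (G0 : form_ge G 0) (Gq : form_le G q).

Let q0 : 0 < q. Proof. by case/andP: q01. Qed.
Let q1 : q < 1. Proof. by case/andP: q01. Qed.
Let GD := ls_linear LG.
Let contr N x : sqnorm N (G x) <= q ^+ 2 * sqnorm N.+1 x.
Proof. exact: sqnorm_contract. Qed.
Let q201 : 0 < q ^+ 2 < 1.
Proof. by rewrite exprn_gt0 // expr_lt1 // ltW. Qed.

(** The partial sums of the series of the [G ^ k x], as an affine iteration. *)
Fixpoint neumann m x : I -> C :=
  if m is k.+1 then fun i => x i + G (neumann k x) i else fun=> 0.

Lemma sqnorm0 N : sqnorm N (fun=> 0) = 0.
Proof.
by apply: big1 => i _; rewrite ComplexField.Normc.normc0 expr0n.
Qed.

Lemma local_sym0 i : G (fun=> 0) i = 0.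
Proof.
have e : (fun _ : I => 0) = (fun _ : I => 0 + (-1) * 0 :> C).
  by apply: funext => j; rewrite mulr0 addr0.
by rewrite e GD mulN1r subrr.
Qed.

Lemma local_symB x y i : G (fun j => x j - y j) i = G x i - G y i.
Proof.
have -> : (fun j => x j - y j) = (fun j => x j + (-1) * y j).
  by apply: funext => j; rewrite mulN1r.
by rewrite GD mulN1r.
Qed.

Lemma neumann_bounded x L m : bounded_by x L -> bounded_by (neumann m x) (L / (1 - q) ^+ 2).
Proof.
move=> xL; have L0 : 0 <= L := le_trans (sqnorm_ge0 0 x) (xL _).
have q1' : 0 < 1 - q by rewrite subr_gt0.
elim: m => [|m IH] N /=.
  by rewrite sqnorm0 divr_ge0 // sqr_ge0.
(* the weights 1 / (1 - q) and 1 / q make the bound a fixed point *)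
have s0 : 0 < q / (1 - q) by rewrite divr_gt0.
apply: le_trans (sqnormD _ _ _ s0) _.
have -> : 1 + q / (1 - q) = (1 - q)^-1 by field; rewrite gt_eqF.
have -> : 1 + (q / (1 - q))^-1 = q^-1 by field; rewrite !gt_eqF.
have h1 : (1 - q)^-1 * sqnorm N x <= (1 - q)^-1 * L.
  by rewrite ler_pM2l ?invr_gt0.
have h2 : q^-1 * sqnorm N (G (neumann m x)) <= q * (L / (1 - q) ^+ 2).
  rewrite ler_pdivrMl // mulrA -expr2; apply: le_trans (contr _ _) _.
  by rewrite ler_pM2l ?exprn_gt0.
apply: le_trans (lerD h1 h2) _; rewrite le_eqVlt; apply/orP; left; apply/eqP.
by field; rewrite gt_eqF.
Qed.

(** The difference of consecutive partial sums is [G ^ m x]. *)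
Lemma neumann_step x L m : bounded_by x L ->
  bounded_by (fun i => neumann m.+1 x i - neumann m x i) ((q ^+ 2) ^+ m * L).
Proof.
move=> xL; elim: m => [|m IH] N.
  rewrite expr0 mul1r; apply: le_trans (xL N); rewrite le_eqVlt; apply/orP; left.
  by apply/eqP/eq_sqnorm => i _ /=; rewrite local_sym0 subr0 addr0.
rewrite (@eq_sqnorm N _ (G (fun i => neumann m.+1 x i - neumann m x i))).
  by apply: le_trans (contr _ _) _; rewrite (exprS _ m) -mulrA ler_pM2l ?exprn_gt0.
by move=> i _; rewrite local_symB /=; ring.
Qed.

(** The geometric rate in each coordinate is uniform over the index set, hence
    the convergence holds in squared norm on every [F N]. *)
Lemma neumann_cvg x L : bounded_by x L -> exists y, forall N (e : R), 0 < e ->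
  exists m0, forall m, (m0 <= m)%N ->
    sqnorm N (fun i => y i - neumann m x i) <= e.
Proof.
move=> xL; have L0 : 0 <= L := le_trans (sqnorm_ge0 0 x) (xL _).
pose D := Num.sqrt L; have D0 : 0 <= D by apply: sqrtr_ge0.
have DL : D ^+ 2 = L by apply: sqr_sqrtr.
have step m i : normc (neumann m.+1 x i - neumann m x i) ^+ 2 <= (D * q ^+ m) ^+ 2.
  have [N iN] := F_cover i.
  apply: le_trans (sqnorm_ge_term (fun i => neumann m.+1 x i - neumann m x i) iN) _.
  by apply: le_trans (neumann_step m xL N) _; rewrite (exprMn _ D) DL mulrC exprAC.
have Dq m : 0 <= D * q ^+ m by rewrite mulr_ge0 // exprn_ge0 // ltW.
have lim i : exists l : C, forall m,
    normc (l - neumann m x i) ^+ 2 <= 2 * (D / (1 - q)) ^+ 2 * (q ^+ 2) ^+ m.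
  have [m|a ha] := @geometric_limit (fun m => Re (neumann m x i)) D q q01 D0.
    rewrite norm_le_sqr //.
    by apply: le_trans (step m i); rewrite normc_sqrB lerDl sqr_ge0.
  have [m|b hb] := @geometric_limit (fun m => Im (neumann m x i)) D q q01 D0.
    rewrite norm_le_sqr //.
    by apply: le_trans (step m i); rewrite normc_sqrB lerDr sqr_ge0.
  exists (a +i* b)%C => m; rewrite normc_sqrB.
  have E0 : 0 <= D / (1 - q) * q ^+ m.
    by rewrite mulr_ge0 ?divr_ge0 ?exprn_ge0 // ?subr_ge0 ltW.
  have := ha m; rewrite norm_le_sqr //.
  have := hb m; rewrite norm_le_sqr //.
  rewrite (exprMn _ (D / (1 - q))) (exprAC q) /=.
  set A := (D / _) ^+ 2 * _; set B := Re _; set B' := Im _.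
  by rewrite -mulrA -/A; lra.
have [y hy] := choice lim; exists y => N e e0.
have [m0 h] := geometric_small ((size (F N))%:R * (2 * (D / (1 - q)) ^+ 2)) q201 e0.
exists m0 => m /h; apply: le_trans; rewrite /sqnorm.
apply: le_trans (_ : \sum_(i <- F N) 2 * (D / (1 - q)) ^+ 2 * (q ^+ 2) ^+ m <= _).
  by apply: ler_sum => i _.
by rewrite big_const_seq count_predT iter_addr_0 -[X in X <= _]mulr_natl !mulrA.
Qed.

Lemma sqnormB N x y : sqnorm N (fun i => x i - y i) <= 2 * sqnorm N x + 2 * sqnorm N y.
Proof. by have := sqnormD N x (fun i => - y i) ltr01; rewrite sqnormN invr1. Qed.

Lemma sqnorm_le0 x : (forall N e, 0 < e -> sqnorm N x <= e) -> forall i, x i = 0.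
Proof.
move=> h i; have [N iN] := F_cover i; apply: ComplexField.Normc.eq0_normc.
apply/eqP; rewrite -sqrf_eq0 eq_le sqr_ge0 andbT.
apply: le_trans (sqnorm_ge_term x iN) _; apply/ler_addgt0Pr => e e0.
by rewrite add0r h.
Qed.

Lemma neumann_solve : exists U, [/\
  forall x L, bounded_by x L -> bounded_by (U x) (4 / (1 - q) ^+ 2 * L) &
  forall x L, bounded_by x L -> forall i, U x i = x i + G (U x) i].
Proof.
have : forall x, exists y, forall L, bounded_by x L -> bounded_by y (4 / (1 - q) ^+ 2 * L) /\
    forall i, y i = x i + G y i.
  move=> x; have [[L0 xL0]|nx] := pselect (exists L, bounded_by x L); last first.
    by exists x => L xL; case: nx; exists L.
  have [y hy] := neumann_cvg xL0; exists y => L xL; split=> [N|i].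
    apply/ler_addgt0Pr => e e0.
    have [m /(_ m (leqnn m)) hm] := hy N (e / 2) (divr_gt0 e0 (ltr0n _ 2)).
    rewrite (@eq_sqnorm N y (fun i => (y i - neumann m x i) - (- neumann m x i))).
      apply: le_trans (sqnormB _ _ _) _; rewrite sqnormN.
      have := neumann_bounded m xL N; rewrite mulrAC -mulrA.
      have L0' : 0 <= L := le_trans (sqnorm_ge0 0 x) (xL _).
      have : 0 <= L / (1 - q) ^+ 2 by rewrite divr_ge0 // sqr_ge0.
      by move: hm; set X := sqnorm _ _; set Y := sqnorm _ _; set W := L / _; lra.
    by move=> i _; ring.
  apply/eqP; rewrite -subr_eq0; apply/eqP.
  apply: (@sqnorm_le0 (fun i => y i - (x i + G y i))) => N e e0.
  have [m1 h1] := hy N (e / 4) (divr_gt0 e0 (ltr0n _ 4)).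
  have [m2 h2] := hy N.+1 (e / 4) (divr_gt0 e0 (ltr0n _ 4)).
  pose m := maxn m1 m2.
  rewrite (@eq_sqnorm N _ (fun i => (y i - neumann m.+1 x i) -
      G (fun j => y j - neumann m x j) i)); last first.
    by move=> j _; rewrite local_symB /=; ring.
  apply: le_trans (sqnormB _ _ _) _.
  have := h1 m.+1 (leqW (leq_maxl _ _)); have := h2 m (leq_maxr _ _).
  have := contr N (fun j => y j - neumann m x j).
  have := sqnorm_ge0 N.+1 (fun j => y j - neumann m x j).
  set X := sqnorm _ _; set Y := sqnorm _ _; set W := sqnorm _ _ => X0 YX Xe We.
  have : q ^+ 2 * X <= X by rewrite ler_piMl // ltW; case/andP: q201.
  lra.
move=> /choice[U hU]; exists U; split=> x L xL; by have [] := hU x L xL.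
Qed.

(** The contraction estimate loses one level of the filtration at each step;
    the bound [L] is uniform over the levels, so it can be iterated. *)
Lemma fixpoint0 y L : bounded_by y L -> (forall i, y i = G y i) -> forall i, y i = 0.
Proof.
move=> yL yG; have h m N : sqnorm N y <= (q ^+ 2) ^+ m * L.
  elim: m N => [|m IH] N; first by rewrite mul1r.
  have -> : sqnorm N y = sqnorm N (G y) by apply: eq_sqnorm => i _.
  by apply: le_trans (contr _ _) _; rewrite (exprS _ m) -mulrA ler_pM2l ?exprn_gt0.
apply: sqnorm_le0 => N e e0; have [m hm] := geometric_small L q201 e0.
by apply: le_trans (h m N) _; rewrite mulrC hm.
Qed.

End Neumann.
(** * The top of the spectrum *)

Section Spectrum.
Variables (T : (I -> C) -> (I -> C)) (M c : R).
Hypotheses (LT : local_sym T) (TM : form_ge T (- M)) (Tc : form_le T c).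

(** With [K] large, [G = 1 - (t - T) / K] has its form between [0] and
    [1 - (t - c) / K < 1], and [t - T = K (1 - G)]. *)
Lemma resolvent_above t : c < t -> ~ spectrum T t%:C.
Proof.
move=> ct; rewrite /spectrum /=; apply; pose K := `|t| + `|M| + `|c| + 1.
have K0 : 0 < K by rewrite /K ltr_wpDl // !addr_ge0.
have KtM : t + M <= K.
  by have := ler_norm t; have := ler_norm M; have := normr_ge0 c; rewrite /K; lra.
have Ktc : t - c < K.
  have := ler_norm t; have := ler_norm (- c); rewrite normrN.
  by have := normr_ge0 M; rewrite /K; lra.
pose a := 1 - t / K; pose b := K^-1; pose q := 1 - (t - c) / K.
have b0 : 0 < b by rewrite invr_gt0.
pose G := affine a b T.
have LG : local_sym G by exact: affine_sym.
have q01 : 0 < q < 1.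
  rewrite /q subr_gt0 ltr_pdivrMr // mul1r Ktc /=.
  by rewrite ltrBlDr ltrDl divr_gt0 // subr_gt0.
have G0 : form_ge G 0.
  move=> N x sx; rewrite mul0r Re_ip_affine.
  have h : b * (- M * sqnorm N x) <= b * Re (ip N x (T x)) by rewrite ler_pM2l // TM.
  apply: le_trans (_ : a * sqnorm N x + b * (- M * sqnorm N x) <= _); last first.
    by rewrite lerD2l.
  have -> : a * sqnorm N x + b * (- M * sqnorm N x) = (1 - (t + M) / K) * sqnorm N x.
    by rewrite /a /b; ring.
  by rewrite mulr_ge0 ?sqnorm_ge0 // subr_ge0 ler_pdivrMr // mul1r.
have Gq : form_le G q.
  move=> N x sx; rewrite Re_ip_affine.
  have h : b * Re (ip N x (T x)) <= b * (c * sqnorm N x) by rewrite ler_pM2l // Tc.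
  apply: le_trans (_ : a * sqnorm N x + b * (c * sqnorm N x) <= _).
    by rewrite lerD2l.
  by rewrite le_eqVlt; apply/orP; left; apply/eqP; rewrite /q /a /b; ring.
have [U [Ub Ue]] := neumann_solve LG q01 G0 Gq.
pose s x := fun i => (- b)%:C * x i.
have sb x L : bounded_by x L -> bounded_by (s x) (b ^+ 2 * L).
  by move=> xL N; rewrite sqnormZ sqrrN ler_pM2l // exprn_gt0.
have KC : K%:C * b%:C = 1 by rewrite -rmorphM /= divff // gt_eqF.
(* [y = - b z + G y] is [T y - t y = z] after division by [b] *)
have eqv (y z : C) (Ty : C) : y = (- b)%:C * z + (a%:C * y + b%:C * Ty) <->
    Ty - t%:C * y = z.
  have ea : a%:C = 1 - t%:C * b%:C by rewrite -rmorphM -rmorphB.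
  have eb : (- b)%:C = - b%:C by rewrite rmorphN.
  split=> [e|<-]; last by rewrite ea eb; ring.
  have e0 : y = y - b%:C * (z - (Ty - t%:C * y)).
    by rewrite {1}e ea eb; ring.
  have /eqP : b%:C * (z - (Ty - t%:C * y)) = 0.
    set X := _ * _ in e0 *; have -> : X = y - (y - X) by ring.
    by rewrite -e0 subrr.
  rewrite mulf_eq0 => /orP[/eqP b00|]; last by rewrite subr_eq0 => /eqP.
  by move: KC; rewrite b00 mulr0 => /esym/eqP; rewrite oner_eq0.
exists (fun x => U (s x)); split.
- apply/bounded_opP; exists (4 / (1 - q) ^+ 2 * b ^+ 2) => x L xL.
  by rewrite -(mulrA _ _ L); apply: Ub; apply: sb.
- move=> x /l2P[L xL].
  pose w i := T x i - t%:C * x i.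
  have xw i : x i = s w i + G x i by apply/eqv.
  have wb : bounded_by w ((2 + 2 * q ^+ 2) * L / b ^+ 2).
    move=> N; rewrite ler_pdivlMr ?exprn_gt0 // mulrC.
    have -> : b ^+ 2 * sqnorm N w = sqnorm N (s w) by rewrite sqnormZ sqrrN.
    rewrite (@eq_sqnorm N _ (fun i => x i - G x i)); last first.
      by move=> i _; apply/esym/eqP; rewrite subr_eq -xw.
    apply: le_trans (sqnormB _ _ _) _.
    have h := sqnorm_contract LG (proj1 (andP q01)) G0 Gq N x.
    have h' : q ^+ 2 * sqnorm N.+1 x <= q ^+ 2 * L by rewrite ler_wpM2l // sqr_ge0.
    by have := xL N; lra.
  have [L' ub] : exists L', bounded_by (U (s w)) L'.
    by eexists; exact: Ub (sb _ _ wb).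
  have zb : bounded_by (fun i => U (s w) i - x i) (2 * L' + 2 * L).
    by move=> N; have := sqnormB N (U (s w)) x; have := ub N; have := xL N; lra.
  have z0 := fixpoint0 LG q01 G0 Gq zb.
  apply: funext => i; apply/eqP; rewrite -subr_eq0; apply/eqP; apply: z0 => {}i.
  by rewrite (local_symB LG) {1}(Ue _ _ (sb _ _ wb)) {1}xw; ring.
- move=> x /l2P[L xL]; apply: funext => i; apply/eqv.
  exact: Ue (sb _ _ xL) i.
Qed.

Variable i0 : I.

(** The witness is the least upper bound of the form.  Were it in the resolvent
    set, the bounded inverse would make the form of [m - T] coercive. *)
Lemma form_bound_spectrum : exists2 m, spectrum T m%:C & form_le T m.
Proof.
pose E : set R := fun t => form_le T t.
have lowE t : form_le T t -> - M <= t.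
  have [N iN] := F_cover i0.
  pose x i : C := if i == i0 then 1 else 0.
  have sx : supported N x.
    by move=> i; rewrite /x; case: eqP => // ->; rewrite iN.
  move=> /(_ N x sx) h; have := le_trans (TM sx) h.
  rewrite ler_pM2r //; apply: lt_le_trans (sqnorm_ge_term x iN).
  by rewrite /x eqxx ComplexField.Normc.normc1 expr1n.
have lbE : has_lbound E by exists (- M) => t; apply: lowE.
have infE : has_inf E by split=> //; exists c.
have Em : form_le T (inf E).
  move=> N x sx; have [n0|n0] := eqVneq (sqnorm N x) 0.
    by have := Tc sx; rewrite n0 !mulr0.
  have np : 0 < sqnorm N x by rewrite lt_neqAle eq_sym n0 sqnorm_ge0.
  rewrite -ler_pdivrMr //; apply: lb_le_inf; first by case: infE.
  by move=> t /(_ N x sx); rewrite ler_pdivrMr.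
exists (inf E) => //; rewrite /spectrum /= => -[U [/bounded_opP[K0 Ub] Ul _]].
set m := inf E in Em Ul *.
pose K := m + M + 1; pose KU := Num.max K0 1.
have Kp : 0 < K by have := lowE _ Em; rewrite /K; lra.
have KUp : 0 < KU by rewrite lt_max ltr01 orbT.
pose B := affine m (-1) T.
have LB : local_sym B by exact: affine_sym.
have B0 : form_ge B 0.
  by move=> N x sx; rewrite Re_ip_affine; have := Em _ _ sx; lra.
have BK : form_le B K.
  move=> N x sx; rewrite Re_ip_affine; have := TM sx; have := sqnorm_ge0 N x.
  by rewrite /K; lra.
pose e := (KU * K)^-1.
have ep : 0 < e by rewrite invr_gt0 mulr_gt0.
have Eme : form_le T (m - e).
  (* apply the assumed inverse to [(T - m) x], then use [|B x|^2 <= K <x, B x>] *)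
  move=> N x sx; have := sqnorm_le_form LB Kp B0 BK sx; rewrite Re_ip_affine => h.
  have x2 : l2 x.
    apply/l2P; exists (sqnorm N x) => N'.
    apply: le_trans (le_sqnorm _ (leq_maxr N N')) _.
    by rewrite (sqnorm_mono (leq_maxl N N') sx).
  pose w i := T x i - m%:C * x i.
  have nw N' : sqnorm N' w = sqnorm N' (B x).
    rewrite -sqnormN; apply: eq_sqnorm => i _; rewrite /w /B /affine rmorphN /=; ring.
  have wb : bounded_by w (sqnorm N.+1 (B x)).
    move=> N'; rewrite nw; apply: le_trans (le_sqnorm _ (leq_maxr N.+1 N')) _.
    by rewrite (sqnorm_mono (leq_maxl N.+1 N') (ls_supp LB sx)).
  have := Ub _ _ wb N; rewrite (Ul x x2) => h1.
  have h2 : K0 * sqnorm N.+1 (B x) <= KU * sqnorm N.+1 (B x).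
    by rewrite ler_wpM2r ?sqnorm_ge0 // le_max lexx.
  have h3 : KU * sqnorm N.+1 (B x) <=
      KU * (K * (m * sqnorm N x + -1 * Re (ip N x (T x)))).
    by rewrite ler_pM2l.
  have : e * sqnorm N x <= m * sqnorm N x + -1 * Re (ip N x (T x)).
    rewrite ler_pdivrMl ?mulr_gt0 // -mulrA.
    exact: le_trans h1 (le_trans h2 h3).
  by lra.
by have := ge_inf lbE Eme; rewrite -/m; lra.
Qed.

(** As [c] is an arbitrary upper bound of the form, the two conclusions identify
    [lambda_max T] as the least one. *)
Lemma lambda_max_form : lambda_max T <= c /\ form_le T (lambda_max T).
Proof.
have [m sm Tm] := form_bound_spectrum.
have ub t : spectrum T t%:C -> t <= c.
  by move=> st; rewrite leNgt; apply/negP => /resolvent_above.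
split.
  by apply: ge_sup => [|t]; [exists m|apply: ub].
move=> N x sx; apply: le_trans (Tm _ _ sx) _; rewrite ler_wpM2r ?sqnorm_ge0 //.
by apply: ub_le_sup => //; exists c => t; apply: ub.
Qed.

End Spectrum.
End LocalOperators.

(** * Words and the Fock space form *)

Section Words.
Variable n : nat.
Local Notation word := (seq 'I_n).

Fixpoint words N : seq word :=
  if N is N'.+1 then [::] :: [seq i :: w | i <- enum 'I_n, w <- words N']
  else [::].

Lemma mem_words N w : (w \in words N) = (size w < N)%N.
Proof.
elim: N w => [|N IH] [|j w] //=; rewrite inE /= ltnS -IH.
apply/allpairsP/idP => [[[i v] /= [_ vN [_ ->]]] //|wN].
by exists (j, w); rewrite mem_enum.
Qed.

Lemma uniq_words N : uniq (words N).
Proof.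
elim: N => //= N IH; apply/andP; split.
  by apply/negP => /allpairsP[[i v] []].
by apply: allpairs_uniq => //; [exact: enum_uniq|move=> [i v] [j w] _ _ [-> ->]].
Qed.

Lemma sub_words N M : (N <= M)%N -> {subset words N <= words M}.
Proof. by move=> NM w; rewrite !mem_words => /leq_trans; apply. Qed.

Lemma big_words (V : nmodType) N (f : word -> V) :
  \sum_(w <- words N.+1) f w
    = f [::] + \sum_(i < n) \sum_(w <- words N) f (i :: w).
Proof. by rewrite /= big_cons big_allpairs_dep big_enum. Qed.

Lemma big_words_mono (V : nmodType) N M (f : word -> V) : (N <= M)%N ->
  (forall w, w \notin words N -> f w = 0) ->
  \sum_(w <- words M) f w = \sum_(w <- words N) f w.
Proof.
apply: big_F_mono; first exact: uniq_words.
by move=> k; apply: sub_words.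
Qed.

End Words.

Arguments words : simpl never.

Section QuadraticForms.
Variables (R : realType) (d : nat).
Local Notation C := R[i].
Local Notation normc := ComplexField.Normc.normc.
Implicit Types (u v : 'cV[C]_d) (M : 'M[C]_d).
Local Open Scope sesquilinear_scope.

Definition dot u v : C := (u ^t* *m v) 0 0.

Lemma dotE u v : dot u v = \sum_b (u b 0)^*%R * v b 0.
Proof. by rewrite /dot mxE; apply: eq_bigr => b _; rewrite !mxE. Qed.

Lemma dot_conj u v : (dot u v)^*%R = dot v u.
Proof.
rewrite !dotE rmorph_sum; apply: eq_bigr => b _.
by rewrite rmorphM /= conjCK mulrC.
Qed.

Lemma dotDr u v v' : dot u (v + v') = dot u v + dot u v'.
Proof. by rewrite /dot mulmxDr mxE. Qed.

Lemma dotZr u v a : dot u (a *: v) = a * dot u v.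
Proof. by rewrite /dot -scalemxAr mxE. Qed.

Lemma dotNr u v : dot u (- v) = - dot u v.
Proof. by rewrite -scaleN1r dotZr mulN1r. Qed.

Lemma dot0r u : dot u 0 = 0.
Proof. by rewrite /dot mulmx0 mxE. Qed.

Lemma dot0l v : dot 0 v = 0.
Proof. by rewrite -dot_conj dot0r conjC0. Qed.

Lemma dotDl u u' v : dot (u + u') v = dot u v + dot u' v.
Proof. by rewrite -dot_conj dotDr rmorphD /= !dot_conj. Qed.

Lemma dotNl u v : dot (- u) v = - dot u v.
Proof. by rewrite -dot_conj dotNr rmorphN /= dot_conj. Qed.

Lemma dotZl u v (a : R) : dot (a%:C *: u) v = a%:C * dot u v.
Proof.
by rewrite -dot_conj dotZr rmorphM /= dot_conj (conj_conjc a%:C) conjc_real.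
Qed.

Lemma dot_sumr (J : Type) (s : seq J) u (f : J -> 'cV[C]_d) :
  dot u (\sum_(j <- s) f j) = \sum_(j <- s) dot u (f j).
Proof.
elim/big_rec2: _ => [|j y1 y2 _ <-]; first by rewrite dot0r.
by rewrite dotDr.
Qed.

Lemma dot_adj M u v : dot u (M *m v) = dot (M ^t* *m u) v.
Proof.
by rewrite /dot trmx_mul map_mxM trmxCK mulmxA.
Qed.

Lemma herm_adj M : M \is hermsymmx -> M ^t* = M.
Proof. by move=> /is_hermitianmxP {2}->; rewrite expr0 scale1r. Qed.

Lemma dot_herm M u v : M \is hermsymmx -> dot u (M *m v) = dot (M *m u) v.
Proof. by move=> /herm_adj h; rewrite dot_adj h. Qed.

Lemma dot_hermC M u v : M \is hermsymmx -> (dot u (M *m v))^*%R = dot v (M *m u).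
Proof. by move=> h; rewrite dot_conj dot_herm. Qed.

Lemma dot_ge0 u : 0 <= dot u u.
Proof. by rewrite dotE sumr_ge0 // => b _; rewrite mulrC mul_conjC_ge0. Qed.

Lemma Re_ge0 (z : C) : 0 <= z -> 0 <= Re z.
Proof. by case: z => a b; rewrite lecE /= => /andP[]. Qed.

(** The sum of the moduli of the entries is a crude constant. *)
Lemma matrix_form_bound M :
  exists K : R, forall u, Re (dot u (M *m u)) <= K * Re (dot u u).
Proof.
exists (\sum_b \sum_b' normc (M b b')) => u.
have e (v : 'cV[C]_d) : Re (dot v v) = \sum_b normc (v b 0) ^+ 2.
  by rewrite dotE Re_sum; apply: eq_bigr => b _; rewrite -normc_sqrE.
have tle b : normc (u b 0) ^+ 2 <= Re (dot u u).
  by rewrite e (bigD1 b) //= lerDl sumr_ge0 // => j _; apply: sqr_ge0.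
rewrite dotE Re_sum mulr_suml; apply: ler_sum => b _.
rewrite mxE mulr_sumr Re_sum mulr_suml; apply: ler_sum => b' _.
have nb (z : C) : Re z <= normc z.
  case: z => x y /=; apply: le_trans (ler_norm _) _.
  by rewrite -sqrtr_sqr ler_wsqrtr // lerDl sqr_ge0.
apply: le_trans (nb _) _; rewrite !ComplexField.Normc.normcM mulrCA.
apply: ler_wpM2l; first by case: (M b b') => x y; apply: sqrtr_ge0.
have -> : normc (u b 0)^*%R = normc (u b 0).
  by rewrite conj_conjc; case: (u b 0) => x y /=; rewrite sqrrN.
have := tle b; have := tle b'; set p := normc _; set r := normc _ => h1 h2.
by have := sqr_ge0 (p - r); rewrite sqrrB; lra.
Qed.

Lemma psd_dot M : psdmx M -> forall v, 0 <= dot v (M *m v).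
Proof. by case=> _ h v; rewrite /dot mulmxA. Qed.

Lemma mxtrace_sum (J : Type) (s : seq J) (f : J -> 'M[C]_d) :
  \tr (\sum_(j <- s) f j) = \sum_(j <- s) \tr (f j).
Proof. exact: raddf_sum. Qed.

Lemma col_mulmx M m (X : 'M[C]_(d, m)) k : M *m col k X = col k (M *m X).
Proof. by rewrite !colE mulmxA. Qed.

Lemma dot_col m (X Y : 'M[C]_(d, m)) k :
  dot (col k X) (col k Y) = (X ^t* *m Y) k k.
Proof. by rewrite /dot !mxE; apply: eq_bigr => j _; rewrite !mxE. Qed.

Lemma sum_dot_col m (X Y : 'M[C]_(d, m)) :
  \sum_k dot (col k X) (col k Y) = \tr (X ^t* *m Y).
Proof. by apply: eq_bigr => k _; rewrite dot_col. Qed.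

Lemma block_dot M Z : psdmx (block_mx M 1%:M 1%:M Z) -> forall u v,
  0 <= dot u (M *m u) + dot u v + dot v u + dot v (Z *m v).
Proof.
case=> _ h u v; have := h (col_mx u v); rewrite -mulmxA mul_block_col !mul1mx.
rewrite tr_col_mx map_row_mx mul_row_col mxE -/(dot _ _) -/(dot _ _) !dotDr.
by rewrite !addrA.
Qed.

End QuadraticForms.


Section FockModel.
Variables (R : realType) (d n : nat).
Local Notation C := R[i].
Local Notation word := (seq 'I_n).
Implicit Types (x y : 'I_d * word -> C) (w : word).

(** The basis vectors of C^d (x) Fock of particle number less than [N]. *)
Definition fock N : seq ('I_d * word) :=
  [seq (b, w) | b <- enum 'I_d, w <- words n N].

Lemma mem_fock N p : (p \in fock N) = (p.2 \in words n N).
Proof.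
case: p => b w; apply/allpairsP/idP => [[[b' w'] /= [_ h [_ ->]]] //|h].
by exists (b, w); rewrite mem_enum.
Qed.

Lemma fock_uniq N : uniq (fock N).
Proof.
apply: allpairs_uniq; [exact: enum_uniq|exact: uniq_words|].
by case=> ? ? [? ?] _ _ [-> ->].
Qed.

Lemma fock_sub N : {subset fock N <= fock N.+1}.
Proof. by move=> p; rewrite !mem_fock; apply: sub_words. Qed.

Lemma fock_cover p : exists N, p \in fock N.
Proof. by exists (size p.2).+1; rewrite mem_fock mem_words. Qed.

Definition component x w : 'cV[C]_d := \col_b x (b, w).

Lemma component_eq0 N x w :
  supported fock N x -> w \notin words n N -> component x w = 0.
Proof.
by move=> sx wN; apply/matrixP => b j; rewrite !mxE sx // mem_fock.
Qed.

Lemma ip_fock N x y :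
  ip fock N x y = \sum_(w <- words n N) dot (component x w) (component y w).
Proof.
rewrite /ip big_allpairs exchange_big /=; apply: eq_bigr => w _.
by rewrite dotE big_enum /=; apply: eq_bigr => b _; rewrite !mxE.
Qed.

Variables (A0 : 'M[C]_d) (A : 'I_n -> 'M[C]_d).

Definition creation_component x w : 'cV[C]_d :=
  if w is j :: v then A j *m component x v else 0.

Lemma component_Xsc x w : component (Xsc A0 A x) w =
  A0 *m component x w + creation_component x w +
  \sum_(i < n) A i *m component x (i :: w).
Proof.
apply/matrixP => b j; rewrite !mxE /Xsc /tensop -addrA; congr (_ + _).
  by apply: eq_bigr => b' _; rewrite !mxE.
transitivity (\sum_i ((\sum_b' A i b b' * creation i (fun v => x (b', v)) w) +
    (A i *m component x (i :: w)) b j)).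
  apply: eq_bigr => i _; rewrite !mxE -big_split /=; apply: eq_bigr => b' _.
  by rewrite !mxE -mulrDr.
rewrite big_split summxE /=; congr (_ + _).
case: w => [|k v] /=.
  by rewrite mxE big1 // => i _; rewrite big1 // => b' _; rewrite mulr0.
rewrite (bigD1 k) //= eqxx [X in _ + X]big1 ?addr0.
  by rewrite !mxE; apply: eq_bigr => b' _; rewrite !mxE.
move=> i ik; rewrite big1 // => b' _.
by rewrite eq_sym (negbTE ik) mulr0.
Qed.

(** The creation part pairs [iw] with [w] after reindexing by the first
    letter. *)
Lemma ip_Xsc N x y : supported fock N x -> ip fock N x (Xsc A0 A y) =
  \sum_(w <- words n N) (dot (component x w) (A0 *m component y w) +
    \sum_(i < n) (dot (component x (i :: w)) (A i *m component y w) +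
                  dot (component x w) (A i *m component y (i :: w)))).
Proof.
move=> sx; rewrite -(ip_monol fock_uniq fock_sub _ (leqnSn N) sx) ip_fock.
under eq_bigr => w _ do rewrite component_Xsc !dotDr dot_sumr -addrA addrCA.
rewrite big_split big_words /= dot0r add0r.
rewrite [X in X + _]exchange_big /=.
rewrite [X in _ + X](big_words_mono (leqnSn N)).
  rewrite -big_split /=; apply: eq_bigr => w _.
  by rewrite big_split /= addrCA.
move=> w wN; rewrite (component_eq0 sx wN) dot0l add0r.
by apply: big1 => i _; rewrite dot0l.
Qed.

Hypotheses (hA0 : A0 \is hermsymmx) (hA : forall i, A i \is hermsymmx).

Lemma Xsc_local_sym : local_sym fock (Xsc A0 A).
Proof.
have compP x p : x p = component x p.2 p.1 0 by rewrite mxE -surjective_pairing.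
split.
- move=> a x y p.
  rewrite compP (compP (Xsc A0 A x)) (compP (Xsc A0 A y)) !component_Xsc.
  have e w : component (fun q => x q + a * y q) w =
      component x w + a *: component y w.
    by apply/matrixP => b j; rewrite !mxE.
  have ec w : creation_component (fun q => x q + a * y q) w =
      creation_component x w + a *: creation_component y w.
    by case: w => [|j v] /=; rewrite ?scaler0 ?addr0 // e mulmxDr scalemxAr.
  rewrite e ec; under eq_bigr => i _ do rewrite e mulmxDr -scalemxAr.
  rewrite big_split /= -scaler_sumr mulmxDr -scalemxAr !mxE !mulrDr.
  by rewrite -!addrA; congr (_ + _); ring.
- move=> N x y e p pN; rewrite compP (compP (Xsc A0 A y)) !component_Xsc.
  move: pN; rewrite mem_fock mem_words; case: p => b w /= wN.
  have ec v : (size v < N.+1)%N -> component x v = component y v.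
    by move=> vN; apply/matrixP => b' j; rewrite !mxE e // mem_fock mem_words.
  rewrite (ec _ (leqW wN)); under eq_bigr => i _ do rewrite (ec (i :: w) wN).
  have -> // : creation_component x w = creation_component y w.
  by case: w wN => //= j v vN; rewrite ec // leqW // ltnW.
- move=> N x sx p; rewrite mem_fock => pN; rewrite compP component_Xsc.
  have z v : (N <= size v)%N -> component x v = 0.
    by move=> vN; apply: (component_eq0 sx); rewrite mem_words -leqNgt.
  move: pN; rewrite mem_words -leqNgt; case: p => b w /= wN.
  rewrite z ?mulmx0 ?add0r ?(ltnW wN) // big1 ?addr0; last first.
    by move=> i _; rewrite z ?mulmx0 //= leqW // ltnW.
  by case: w wN => [|j v] //= vN; rewrite ?z ?mulmx0 ?mxE.
- move=> N x y sx sy.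
  rewrite -[RHS]ip_conj !ip_Xsc // rmorph_sum /=; apply: eq_bigr => w _.
  rewrite rmorphD rmorph_sum /= dot_hermC //; congr (_ + _).
  apply: eq_bigr => i _; rewrite rmorphD /= addrC.
  rewrite (dot_hermC (component y w) _ (hA i)).
  by rewrite (dot_hermC (component y (i :: w)) _ (hA i)).
Qed.

Lemma sqnorm_fock N x :
  sqnorm fock N x = \sum_(w <- words n N) Re (dot (component x w) (component x w)).
Proof. by rewrite -Re_ip ip_fock Re_sum. Qed.

Lemma Re_ip_Xsc N x : supported fock N x -> Re (ip fock N x (Xsc A0 A x)) =
  \sum_(w <- words n N) (Re (dot (component x w) (A0 *m component x w)) +
    \sum_(i < n) 2 * Re (dot (component x (i :: w)) (A i *m component x w))).
Proof.
move=> sx; rewrite ip_Xsc // Re_sum; apply: eq_bigr => w _.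
rewrite cReD Re_sum; congr (_ + _); apply: eq_bigr => i _.
have e : dot (component x w) (A i *m component x (i :: w))
    = (dot (component x (i :: w)) (A i *m component x w))^*%R.
  by rewrite (dot_hermC _ _ (hA i)).
by rewrite cReD e cRe_conj; lra.
Qed.

(** The first hypothesis bounds the interaction of [iw] with [w] by a [W]-term at
    [iw] and a [Z]-term at [w].  Summed over words, the [W]-terms miss only
    the empty word. *)
Lemma Xsc_form_le (W Z : 'M[C]_d) c :
  (forall u v : 'cV_d,
    2 * Re (dot u v) <= Re (dot u (W *m u)) + Re (dot v (Z *m v))) ->
  (forall u : 'cV_d, Re (dot u ((A0 + Phi A Z + W) *m u)) <= c * Re (dot u u)) ->
  form_le fock (Xsc A0 A) c.
Proof.
move=> hWZ hc N x sx; rewrite Re_ip_Xsc // sqnorm_fock mulr_sumr.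
have W0 u : 0 <= Re (dot u (W *m u)).
  by have := hWZ u 0; rewrite mulmx0 !dot0r /=; lra.
pose f w := Re (dot (component x w) (W *m component x w)).
have hf : \sum_(w <- words n N) \sum_(i < n) f (i :: w) <=
    \sum_(w <- words n N) f w.
  have -> : \sum_(w <- words n N) f w = \sum_(w <- words n N.+1) f w.
    rewrite (big_words_mono (leqnSn N)) // => w wN.
    by rewrite /f (component_eq0 sx wN) dot0l.
  by rewrite big_words exchange_big /= lerDr W0.
apply: le_trans (_ : \sum_(w <- words n N)
  (Re (dot (component x w) ((A0 + Phi A Z) *m component x w)) +
   \sum_(i < n) f (i :: w)) <= _).
  apply: ler_sum => w _; rewrite mulmxDl dotDr cReD -addrA lerD2l.
  rewrite /Phi mulmx_suml dot_sumr Re_sum -big_split /=; apply: ler_sum => i _.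
  rewrite -!mulmxA (dot_herm (component x w) _ (hA i)) addrC; exact: hWZ.
rewrite big_split /=; apply: le_trans (lerD (lexx _) hf) _.
rewrite -big_split /=; apply: ler_sum => w _.
by rewrite -cReD -dotDr -mulmxDl hc.
Qed.

End FockModel.

(** * Positive matrices *)

Section PositiveMatrices.
Variables (R : realType) (d : nat).
Local Notation C := R[i].
Local Open Scope sesquilinear_scope.
Implicit Types (u v : 'cV[C]_d) (M S W Z : 'M[C]_d).

(** Take the square roots of the eigenvalues in a unitary diagonalization. *)
Lemma psd_factor S : psdmx S -> exists V : 'M[C]_d, S = V *m V ^t*.
Proof.
move=> Spsd; have [Sh _] := Spsd.
have /orthomx_spectralP := hermitian_normalmx Sh.
set P := spectralmx S; set D := spectral_diag S => SE.
have Pu : P \is unitarymx := spectral_unitarymx S.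
move: SE; rewrite invmx_unitary // => SE.
have D0 j : 0 <= D 0 j.
  have /unitarymxP PP := Pu.
  have := psd_dot Spsd (col j (P ^t*)).
  rewrite col_mulmx dot_col trmxCK SE -!mulmxA PP mulmx1 mulmxA PP mul1mx.
  by rewrite mxE eqxx mulr1n.
pose E := diag_mx (\row_j sqrtC (D 0 j)).
exists (P ^t* *m E); rewrite trmx_mul map_mxM trmxCK SE -!mulmxA; congr (_ *m _).
rewrite mulmxA; congr (_ *m _).
rewrite /E tr_diag_mx map_diag_mx mulmx_diag; congr diag_mx.
apply/matrixP => i j; rewrite !mxE ord1.
by rewrite /= conj_Creal ?ger0_real ?sqrtC_ge0 // -expr2 sqrtCK.
Qed.

Lemma tr_herm_real M S :
  M \is hermsymmx -> S \is hermsymmx -> Im (\tr (M *m S)) = 0.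
Proof.
move=> /herm_adj hM /herm_adj hS.
have : (\tr (M *m S))^*%R = \tr (M *m S).
  by rewrite -trace_map_mx -mxtrace_tr map_trmx trmx_mul map_mxM hM hS mxtrace_mulC.
rewrite conj_conjc; case: (\tr _) => a b [] /=; lra.
Qed.

(** If [Z y = 0] then the block form at [(s y, y)] is
    [s^2 <y, M y> + 2 s |y|^2], which is negative for small negative [s] unless
    [y = 0]. *)
Lemma block_unit M Z : Z \is hermsymmx -> psdmx (block_mx M 1%:M 1%:M Z) ->
  Z \in unitmx.
Proof.
move=> /herm_adj Zh /block_dot h; rewrite unitmxE unitfE.
apply/negP => /det0P[v v0 vZ].
pose y := v ^t*.
have Zy : Z *m y = 0.
  by rewrite -(trmxCK (Z *m y)) trmx_mul map_mxM trmxCK Zh vZ trmx0 map_mx0.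
have quad (s : R) : 0 <= s ^+ 2 * Re (dot y (M *m y)) + 2 * s * Re (dot y y).
  have := Re_ge0 (h (s%:C *: y) y); rewrite Zy dot0r addr0 !cReD.
  rewrite -scalemxAr !(dotZr, dotZl) !cReZ.
  by move: (Re (dot y (M *m y))) (Re (dot y y)) => p m; lra.
have n0 : Re (dot y y) <= 0.
  set p := Re (dot y (M *m y)) in quad; set m := Re (dot y y) in quad *.
  have K0 : 0 < `|p| + 1 by rewrite ltr_wpDl.
  pose b := m / (`|p| + 1).
  have mE : m = b * (`|p| + 1) by rewrite divfK // gt_eqF.
  have pK : 0 <= `|p| + 1 - p by have := ler_norm p; lra.
  have b2 : b ^+ 2 * (`|p| + 1) <= 0.
    by have := quad (- b); have := mulr_ge0 (sqr_ge0 b) pK; rewrite mE; lra.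
  rewrite pmulr_lle0 // in b2.
  have : b ^+ 2 == 0 by rewrite eq_le b2 sqr_ge0.
  by rewrite sqrf_eq0 mE => /eqP ->; rewrite mul0r.
have y0 b : y b 0 = 0.
  apply: ComplexField.Normc.eq0_normc; apply/eqP.
  rewrite -sqrf_eq0 eq_le sqr_ge0 andbT.
  apply: le_trans n0; rewrite dotE Re_sum (bigD1 b) //= -normc_sqrE lerDl.
  by apply: sumr_ge0 => j _; rewrite -normc_sqrE sqr_ge0.
case/eqP: v0; apply/matrixP => i j; rewrite ord1 mxE; apply/eqP.
by have := y0 j; rewrite !mxE => /eqP; rewrite conjC_eq0.
Qed.

Lemma invmx_herm Z : Z \is hermsymmx -> Z \in unitmx -> invmx Z \is hermsymmx.
Proof.
move=> /herm_adj Zh Zu; apply/is_hermitianmxP; rewrite expr0 scale1r.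
by rewrite trmx_inv map_invmx Zh.
Qed.

(** This is [0 <= <v - W u, Z (v - W u)>]. *)
Lemma young_dot W Z : W \is hermsymmx -> W *m Z = 1%:M -> Z *m W = 1%:M ->
  (forall v, 0 <= Re (dot v (Z *m v))) ->
  forall u v, 2 * Re (dot u v) <= Re (dot u (W *m u)) + Re (dot v (Z *m v)).
Proof.
move=> Wh WZ ZW Z0 u v; have := Z0 (v - W *m u).
rewrite mulmxBr mulmxA ZW mul1mx !dotDl !dotDr !dotNl !dotNr.
rewrite -!(dot_herm _ _ Wh) mulmxA WZ mul1mx !(cReD, cReN).
by rewrite -(dot_conj u v) cRe_conj; lra.
Qed.

(** Minimize the block form over the second vector: take [v = - Z^-1 u]. *)
Lemma schur_dot M Z : Z \is hermsymmx -> psdmx (block_mx M 1%:M 1%:M Z) ->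
  forall u, Re (dot u (invmx Z *m u)) <= Re (dot u (M *m u)).
Proof.
move=> Zh hM u; have Zu := block_unit Zh hM; have Wh := invmx_herm Zh Zu.
have := Re_ge0 (block_dot hM u (- (invmx Z *m u))).
rewrite mulmxN mulmxA (mulmxV Zu) mul1mx !dotNl !dotNr opprK.
rewrite -(dot_herm u u Wh) !(cReD, cReN).
by move: (Re (dot u (M *m u))) (Re (dot u (invmx Z *m u))) => p q; lra.
Qed.

End PositiveMatrices.

(** * Trial vectors for the lower bound *)

Section TrialVectors.
Variables (R : realType) (d n : nat).
Local Notation C := R[i].
Local Notation word := (seq 'I_n).
Local Open Scope sesquilinear_scope.
Variables (A : 'I_n -> 'M[C]_d) (Z S V : 'M[C]_d) (rho : R).
Hypotheses (hA : forall i, A i \is hermsymmx) (hZ : Z \is hermsymmx).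
Hypotheses (Zu : Z \in unitmx) (SV : S = V *m V ^t*).
Hypotheses (rho0 : 0 < rho) (hPsi : Psi A Z S = rho%:C *: S).

Let k : R := (Num.sqrt rho)^-1.
Let r : R := Num.sqrt rho.

(** All trial vectors at once: column [b] of [trial w] is the component along
    [w] of the [b]-th vector. *)
Fixpoint trial (w : word) : 'M[C]_d :=
  if w is i :: v then k%:C *: (Z *m A i *m trial v) else V.

Let r0 : 0 < r. Proof. by rewrite sqrtr_gt0. Qed.

Lemma trial_cons i w : A i *m trial w = r%:C *: (invmx Z *m trial (i :: w)).
Proof.
rewrite /= -scalemxAr scalerA -rmorphM /= /k divff ?gt_eqF // scale1r.
by rewrite !mulmxA mulVmx // mul1mx.
Qed.

Lemma PhiZ a M : Phi A (a *: M) = a *: Phi A M.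
Proof.
by rewrite /Phi scaler_sumr; apply: eq_bigr => i _; rewrite -scalemxAr -scalemxAl.
Qed.

(** Prepending a letter turns the sum [M] of the [Y_w Y_w^*] into [rho^-1 Psi M], so each
    length contributes [S]. *)
Lemma trial_moment N :
  \sum_(w <- words n N) trial w *m (trial w) ^t* = N%:R *: S.
Proof.
elim: N => [|N IH]; first by rewrite big_nil scale0r.
rewrite big_words /= -SV -natr1 scalerDl scale1r addrC; congr (_ + _).
transitivity ((rho^-1)%:C *: Psi A Z
    (\sum_(w <- words n N) trial w *m (trial w) ^t*)).
  rewrite /Psi /Phi mulmx_sumr mulmx_suml scaler_sumr; apply: eq_bigr => i _.
  rewrite mulmx_sumr !mulmx_suml mulmx_sumr mulmx_suml scaler_sumr.
  apply: eq_bigr => w _.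
  have adjZ (a : R) (X : 'M[C]_d) : (a%:C *: X) ^t* = a%:C *: X ^t*.
    by apply/matrixP => b b'; rewrite !mxE rmorphM /= (conj_conjc a%:C) conjc_real.
  rewrite adjZ -scalemxAl -scalemxAr scalerA -rmorphM /= /k.
  rewrite -expr2 exprVn sqr_sqrtr ?ltW //.
  rewrite !trmx_mul !map_mxM (herm_adj hZ) (herm_adj (hA i)).
  by rewrite !mulmxA.
rewrite IH /Psi PhiZ -scalemxAr -scalemxAl -/(Psi A Z S) hPsi !scalerA.
have e : (rho^-1)%:C * rho%:C = 1 by rewrite -rmorphM /= mulVf ?gt_eqF.
by rewrite -mulrA mulrCA e mulr1.
Qed.

Variable A0 : 'M[C]_d.

(** Sum the form bound over the [d] trial vectors, cut off to words of length at
    most [N].  By [trial_cons] the interaction of [iw] with [w] is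
    [sqrt rho tr (Y_(iw)^* W Y_(iw))]; it is lost when [w] has length [N],
    whence the factor [N] rather than [N + 1]. *)
Lemma trial_bound c : form_le (@fock d n) (Xsc A0 A) c -> \tr S = 1 ->
  forall N, N.+1%:R * Re (\tr (A0 *m S)) + 2 * r * (N%:R * Re (\tr (invmx Z *m S)))
    <= c * N.+1%:R.
Proof.
move=> hc S1 N.
pose x (b : 'I_d) (p : 'I_d * word) : C :=
  if p.2 \in words n N.+1 then trial p.2 p.1 b else 0.
have cx b w : component (x b) w = if w \in words n N.+1 then col b (trial w) else 0.
  by apply/matrixP => j j'; rewrite !mxE /x /=; case: ifP => _; rewrite !mxE.
have sx b : supported (@fock d n) N.+1 (x b).
  by move=> p; rewrite mem_fock /x => /negbTE ->.
have : \sum_b Re (ip (@fock d n) N.+1 (x b) (Xsc A0 A (x b)))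
    <= \sum_b c * sqnorm (@fock d n) N.+1 (x b).
  by apply: ler_sum => b _; exact: hc.
have nat_C (m : nat) : (m%:R : C) = (m%:R : R)%:C by rewrite rmorph_nat.
have -> : \sum_b c * sqnorm (@fock d n) N.+1 (x b) = c * N.+1%:R.
  rewrite -mulr_sumr; congr (_ * _).
  under eq_bigr => b _ do rewrite sqnorm_fock.
  rewrite exchange_big /=.
  transitivity (Re (\tr (\sum_(w <- words n N.+1) trial w *m (trial w) ^t*))).
    rewrite mxtrace_sum Re_sum; apply: eq_big_seq => w wN.
    rewrite mxtrace_mulC -sum_dot_col Re_sum; apply: eq_bigr => b _.
    by rewrite !cx wN.
  by rewrite trial_moment mxtraceZ S1 mulr1 nat_C.
suff -> : \sum_b Re (ip (@fock d n) N.+1 (x b) (Xsc A0 A (x b))) =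
  N.+1%:R * Re (\tr (A0 *m S)) + 2 * r * (N%:R * Re (\tr (invmx Z *m S))) by [].
under eq_bigr => b _ do rewrite Re_ip_Xsc // big_split /=.
rewrite big_split /=; congr (_ + _).
  rewrite exchange_big /=.
  transitivity (Re (\tr (A0 *m \sum_(w <- words n N.+1) trial w *m (trial w) ^t*))).
    rewrite mulmx_sumr mxtrace_sum Re_sum; apply: eq_big_seq => w wN.
    rewrite mulmxA mxtrace_mulC -sum_dot_col Re_sum; apply: eq_bigr => b _.
    by rewrite !cx wN -col_mulmx.
  by rewrite trial_moment -scalemxAr mxtraceZ nat_C cReZ.
have step : \sum_(i < n) \sum_(w <- words n N)
    trial (i :: w) *m (trial (i :: w)) ^t*
    = N%:R *: S.
  have := trial_moment N.+1; rewrite big_words -natr1 scalerDl scale1r addrC /= -SV.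
  exact: addIr.
transitivity (Re (2 * r%:C * \tr (invmx Z *m
    \sum_(i < n) \sum_(w <- words n N)
      trial (i :: w) *m (trial (i :: w)) ^t*))); last first.
  by rewrite step -scalemxAr mxtraceZ !nat_C -rmorphM /= cReZ cReZ.
rewrite exchange_big /= (big_words_mono (leqnSn N)); last first.
  move=> w wN; rewrite big1 // => b _; rewrite big1 // => i _.
  by rewrite !cx mem_words /= ltnS -mem_words (negbTE wN) dot0l mulr0.
rewrite [in RHS]exchange_big /= mulmx_sumr mxtrace_sum mulr_sumr Re_sum.
apply: eq_big_seq => w wN.
rewrite mulmx_sumr mxtrace_sum mulr_sumr Re_sum exchange_big.
apply: eq_bigr => i _; rewrite mulmxA mxtrace_mulC -sum_dot_col mulr_sumr Re_sum.
apply: eq_bigr => b _.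
have wN1 : w \in words n N.+1 by apply: sub_words wN.
have iwN1 : (i :: w) \in words n N.+1 by rewrite mem_words /= ltnS -mem_words.
rewrite !cx wN1 iwN1 col_mulmx trial_cons.
have colZ (X : 'M[C]_d) : col b (r%:C *: X) = r%:C *: col b X.
  by apply/matrixP => j j'; rewrite !mxE.
by rewrite colZ dotZr (nat_C 2%N) -rmorphM /= !cReZ mulrA.
Qed.

End TrialVectors.

(** * Conclusion *)

Lemma Phi_adj (R : realType) (d n : nat) (A : 'I_n -> 'M[R[i]]_d) (Z : 'M[R[i]]_d) :
  (forall i, A i \is hermsymmx) -> Z \is hermsymmx ->
  ((Phi A Z) ^t*)%sesqui = Phi A Z.
Proof.
move=> hA hZ; rewrite /Phi raddf_sum map_mx_sum /=; apply: eq_bigr => i _.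
by rewrite !trmx_mul !map_mxM (herm_adj hZ) (herm_adj (hA i)) mulmxA.
Qed.

Section LambdaSc.
Variables (R : realType) (d n : nat).
Local Notation C := R[i].
Variables (A0 : 'M[C]_d) (A : 'I_n -> 'M[C]_d).
Hypotheses (hA0 : A0 \is hermsymmx) (hA : forall i, A i \is hermsymmx).

Lemma herm_opp (M : 'M[C]_d) : M \is hermsymmx -> - M \is hermsymmx.
Proof.
move=> /herm_adj h; apply/is_hermitianmxP; rewrite expr0 scale1r.
by rewrite linearN map_mxN h.
Qed.

(** A lower bound for the form is an upper bound for [Xsc (- A0) (- A)], for
    which [W = Z = 1] suffices. *)
Lemma Xsc_form_ge : exists M, form_ge (@fock d n) (Xsc A0 A) (- M).
Proof.
have [M hM] := matrix_form_bound (- A0 + Phi (fun i => - A i) 1%:M + 1%:M).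
exists M => N x sx.
have hA' i : - A i \is hermsymmx by exact: herm_opp.
have h : form_le (@fock d n) (Xsc (- A0) (fun i => - A i)) M.
  apply: (@Xsc_form_le _ _ _ _ _ hA' 1%:M 1%:M _ _ hM).
  move=> u v; rewrite !mul1mx; have := Re_ge0 (dot_ge0 (u - v)).
  rewrite !dotDl !dotDr !dotNl !dotNr !(cReD, cReN).
  by rewrite -(dot_conj u v) cRe_conj; lra.
have := h N x sx; rewrite (Re_ip_Xsc _ hA' sx) (Re_ip_Xsc _ hA sx).
move=> hle; rewrite mulNr lerNl; apply: le_trans hle.
rewrite le_eqVlt; apply/orP; left; apply/eqP; rewrite -sumrN; apply: eq_bigr => w _.
rewrite mulNmx dotNr cReN opprD -sumrN; congr (_ + _); apply: eq_bigr => i _.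
by rewrite mulNmx dotNr cReN mulrN.
Qed.

Lemma Lambda_sc_form (hd : (0 < d)%N) (Z W : 'M[C]_d) c :
  (forall u v : 'cV_d,
    2 * Re (dot u v) <= Re (dot u (W *m u)) + Re (dot v (Z *m v))) ->
  (forall u : 'cV_d, Re (dot u ((A0 + Phi A Z + W) *m u)) <= c * Re (dot u u)) ->
  Lambda_sc A0 A <= c /\ form_le (@fock d n) (Xsc A0 A) (Lambda_sc A0 A).
Proof.
move=> hWZ hc; have [M hM] := Xsc_form_ge.
apply: (lambda_max_form (@fock_uniq d n) (@fock_sub d n) (@fock_cover d n)
  (Xsc_local_sym hA0 hA) hM); last exact: (Ordinal hd, [::]).
exact: Xsc_form_le hc.
Qed.

End LambdaSc.

Theorem lemma4p7 (R : realType) (d n : nat) (hd : (1 <= d)%N) (hn : (1 <= n)%N)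
  (A0 : 'M[R[i]]_d) (A : 'I_n -> 'M[R[i]]_d)
  (hA0 : A0 \is hermsymmx) (hA : forall i, A i \is hermsymmx)
  (c : R) (Z : 'M[R[i]]_d) (hZ : Z \is hermsymmx)
  (hcZ : psdmx (block_mx (c%:C%:M - A0 - Phi A Z) 1%:M 1%:M Z))
  (S : 'M[R[i]]_d) (hS : psdmx S) (hStr : \tr S = 1)
  (rho : R) (hrho : 0 < rho) (hPsi : Psi A Z S = rho%:C *: S) :
  c%:C - mxinner (c%:C%:M - A0 - Phi A Z - invmx Z) S
       - ((Num.sqrt rho - 1) ^+ 2)%:C * mxinner (invmx Z) S
    <= (Lambda_sc A0 A)%:C
  /\ Lambda_sc A0 A <= c.
Proof.
have Zu := block_unit hZ hcZ; have Wh := invmx_herm hZ Zu.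
set W := invmx Z in Wh *.
have Z0 v : 0 <= Re (dot v (Z *m v)).
  by have := Re_ge0 (block_dot hcZ 0 v); rewrite !dot0l dot0r !add0r.
have [Lc hL] : Lambda_sc A0 A <= c /\
    form_le (@fock d n) (Xsc A0 A) (Lambda_sc A0 A).
  apply: (@Lambda_sc_form _ _ _ _ _ hA0 hA hd Z W).
    by apply: young_dot => //; [exact: mulVmx|exact: mulmxV].
  move=> u; have := schur_dot hZ hcZ u.
  rewrite !mulmxBl !mulmxDl !dotDr !dotNr mul_scalar_mx dotZr !(cReD, cReN) cReZ.
  rewrite -/W; move: (Re (dot u (W *m u))) (Re (dot u (A0 *m u))) => p q.
  by move: (Re (dot u (Phi A Z *m u))) (Re (dot u u)) => p' q'; lra.
split=> //.
have [V SV] := psd_factor hS.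
set r := Num.sqrt rho; set L := Lambda_sc A0 A in hL *.
have Sh : S \is hermsymmx by case: hS.
have rr : r ^+ 2 = rho by rewrite sqr_sqrtr // ltW.
set a := \tr (A0 *m S); set b := \tr (W *m S).
have bound : Re a + 2 * r * Re b <= L.
  have h N := trial_bound hA hZ Zu SV hrho hPsi hL hStr N.
  rewrite leNgt; apply/negP => gtL.
  (* the defect [2 r b] stays bounded while the excess grows like [(N + 1) e] *)
  pose e := Re a + 2 * r * Re b - L; have e0 : 0 < e by rewrite subr_gt0.
  have [N hN] : exists N : nat, 2 * r * Re b / e < N%:R.
    exists (Num.bound `|2 * r * Re b / e|).
    by apply: le_lt_trans (ler_norm _) _; apply: archi_boundP.
  move: hN; rewrite ltr_pdivrMr // => hN.
  have := h N; rewrite -/a -/b -/r -natr1 => hN'.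
  have : N%:R * e + e <= 2 * r * Re b by rewrite /e; lra.
  by lra.
(* multiplying [hPsi] by [Z^-1] on the right gives [Z Phi(S) = rho S W] *)
have trPhi : \tr (Phi A Z *m S) = rho%:C * b.
  have e : Z *m Phi A S = rho%:C *: (S *m W).
    by rewrite scalemxAl -hPsi /Psi mulmxK.
  transitivity (\tr (Z *m Phi A S)); last first.
    by rewrite e mxtraceZ mxtrace_mulC.
  rewrite /Phi mulmx_suml mulmx_sumr !mxtrace_sum; apply: eq_bigr => i _.
  by rewrite -!mulmxA mxtrace_mulC !mulmxA.
have -> : mxinner (c%:C%:M - A0 - Phi A Z - W) S = c%:C - a - rho%:C * b - b.
  rewrite /mxinner !(linearB, map_mxB) /= (herm_adj hA0) (herm_adj Wh) Phi_adj //.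
  rewrite tr_scalar_mx map_scalar_mx /= (conj_conjc c%:C) conjc_real.
  by rewrite !mulmxBl !raddfB /= mul_scalar_mx mxtraceZ hStr mulr1 trPhi.
have -> : mxinner W S = b by rewrite /mxinner (herm_adj Wh).
have ai : Im a = 0 by exact: tr_herm_real.
have bi : Im b = 0 by exact: tr_herm_real.
rewrite lecE !(cReD, cReN, cImD, cImN) !(cReZ, cImZ) ai bi /=.
by apply/andP; split; [apply/eqP; ring|rewrite -rr; lra].
Qed.
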